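(* Let $\beta>0$ be an irrational number. For $b>0$ let $X_b$ be a random variable uniformly distributed on $[0,b]$ and let $$Y_b:=\cos(X_b)+\cos(\beta X_b)+\cos((1+\beta)X_b).$$ Let $A$ be a Rademacher random variable (taking the values $\pm1$ with probability $1/2$ each) independent of $X_b$. Let $T$ and $H$ be random variables with laws $\varrho_{\mathcal{T}^*}$ and $\varrho_{\mathcal{H}}$, respectively (the spectral densities of the triangular lattice with loops $\mathcal{T}^*$ and of the hexagonal lattice $\mathcal{H}$). Then, as $b\to\infty$, $$3+2Y_b\ \xrightarrow{d}\ T\qquad\text{and}\qquad A\sqrt{3+2Y_b}\ \xrightarrow{d}\ H,$$ where $\xrightarrow{d}$ denotes convergence in distribution.
   Context: The hexagonal lattice $\mathcal{H}$ is the infinite graph with vertex set $V(\mathcal{H})=\{(\sqrt3\,x+\tfrac{\sqrt3}{2}y,\ \tfrac{3}{2}y+c)\in\mathbb{R}^2 : x,y\in\mathbb{Z},\ c\in\{0,1\}\}$, in which every vertex is joined by an edge to its three nearest neighbours in $V(\mathcal{H})$ (Euclidean distance). The triangular lattice $\mathcal{T}$ has vertex set $V(\mathcal{T})=\{v\in V(\mathcal{H}): c=0\}$, in which every vertex is joined by an edge to its six nearest neighbours in $V(\mathcal{T})$. The graph $\mathcal{T}^*$ is obtained from $\mathcal{T}$ by adding three loops at every vertex (equivalently, one loop of weight $3$; each of the three loops counts as a distinct possible step from a vertex to itself). For $\mathcal{L}\in\{\mathcal{H},\mathcal{T}^*\}$, $\mu_k(\mathcal{L})$ denotes the number of closed paths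 (closed walks; vertices and edges may repeat) of length $k$ on $\mathcal{L}$ starting and ending at a fixed vertex; it does not depend on the vertex. The spectral density $\varrho_{\mathcal{L}}$ is the unique compactly supported Borel probability measure on $\mathbb{R}$ with $\int_{\mathbb{R}}x^k\,d\varrho_{\mathcal{L}}(x)=\mu_k(\mathcal{L})$ for all $k\in\mathbb{N}$. *)

(* Defs.v *)
From HB Require Import structures.
From mathcomp Require Import all_boot all_order all_algebra.
From mathcomp Require Import finmap.
From mathcomp Require Import all_classical all_reals all_analysis.
From mathcomp Require Import ring lra zify.

Set Implicit Arguments.
Unset Strict Implicit.
Unset Printing Implicit Defensive.
Import Order.TTheory GRing.Theory Num.Theory.
Import numFieldNormedType.Exports.

Local Open Scope classical_set_scope.
Local Open Scope card_scope.
Local Open Scope ring_scope.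

Section walks.
Context {V : choiceType}.

(* A multigraph is given by [m u w], the number of edges leading from [u] to
   [w]; a loop counts for one edge.  Each step of a walk records the vertex
   reached and the index of the edge used among the parallel ones. *)
Fixpoint is_walk (m : V -> V -> nat) (u : V) (s : seq (V * nat)) (v : V) :
    Prop :=
  match s with
  | [::] => u = v
  | (w, e) :: s' => (e < m u w)%N /\ is_walk m w s' v
  end.

Definition closed_walks (m : V -> V -> nat) (v : V) (k : nat) :
    set (seq (V * nat)) :=
  [set s | size s = k /\ is_walk m v s v].

(* [fset_set] of an infinite set is empty: the count is meaningful because the
   set is finite when [m] is locally finite ([finite_closed_walks]), as both
   lattices are ([finite_hex_edges], [finite_tri_loop_edges]). *)
Definition nb_closed_walks (m : V -> V -> nat) (v : V) (k : nat) : nat :=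
  #|` fset_set (closed_walks m v k)|.

Lemma finite_closed_walks (m : V -> V -> nat) (v : V) (k : nat) :
  (forall u, finite_set [set w | (0 < m u w)%N]) ->
  finite_set (closed_walks m v k).
Proof.
move=> mfin; rewrite /closed_walks; move: {1}v => u; elim: k u => [|k IHk] u.
  apply: (sub_finite_set (B := [set [::]])); last exact: finite_set1.
  by move=> s [/size0nil].
apply: (sub_finite_set (B := \bigcup_(w in [set w | (0 < m u w)%N])
    \bigcup_(e in `I_(m u w))
      (cons (w, e) @` [set s | size s = k /\ is_walk m w s v]))).
  case=> [|[w e] s] [//= [sk] [ew ws]].
  by exists w; [exact: leq_ltn_trans ew|exists e => //; exists s].
apply: bigcup_finite => [|w _]; first exact: mfin.
by apply: bigcup_finite => [|e _]; [exact: finite_II|exact: finite_image].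
Qed.

End walks.

Lemma uniq_card (T : choiceType) (s : seq T) :
  uniq s -> [set` s] #= `I_(size s).
Proof.
move=> us; have -> : [set` s] = [set` [fset x in s]%fset].
  by apply/seteqP; split => x /=; rewrite in_fset.
by apply/card_eq_fsetP; rewrite card_fseq undup_id.
Qed.

Section lattices.
Context {R : realType}.
Implicit Types (u v w : R * R).

(* The norm of the product space R * R is the sup norm, whence: *)
Definition eucl_dist u w : R :=
  Num.sqrt ((u.1 - w.1) ^+ 2 + (u.2 - w.2) ^+ 2).

Definition lattice_point (x y : int) (c : bool) : R * R :=
  (Num.sqrt 3 * x%:~R + Num.sqrt 3 / 2 * y%:~R, 3 / 2 * y%:~R + c%:R).

Definition hex_vertices : set (R * R) :=
  [set p | exists x y c, p = lattice_point x y c].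

Definition tri_vertices : set (R * R) :=
  [set p | exists x y, p = lattice_point x y false].

(* The minimisers of the distance to [u]; [card_hex_neighbours] and
   [card_tri_neighbours] show that there are three of them in the hexagonal and
   six in the triangular lattice. *)
Definition nearest_neighbour (S : set (R * R)) u w : Prop :=
  [/\ S u, S w, w <> u
    & forall z, S z -> z <> u -> eucl_dist u w <= eucl_dist u z].

Definition hex_edges u w : nat := `[< nearest_neighbour hex_vertices u w >].

Definition tri_loop_edges u w : nat :=
  (`[< nearest_neighbour tri_vertices u w >] +
   3 * `[< tri_vertices u /\ u = w >])%N.

(* The integer whose square root is the distance of two lattice points. *)
Definition sqdist (x y : int) (c : bool) (x' y' : int) (c' : bool) : int :=
  let a := x' - x in let b := y' - y in let e := c'%:Z - c%:Z in
  3 * (a ^+ 2 + a * b + b ^+ 2 + b * e) + e ^+ 2.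

Lemma eucl_dist_lattice x y c x' y' c' :
  eucl_dist (lattice_point x y c : R * R) (lattice_point x' y' c') =
  Num.sqrt (sqdist x y c x' y' c')%:~R.
Proof.
rewrite /eucl_dist /lattice_point/=; congr Num.sqrt.
have s3 : (Num.sqrt 3 : R) ^+ 2 = 3 by rewrite sqr_sqrtr.
have -> : Num.sqrt 3 * x%:~R + Num.sqrt 3 / 2 * y%:~R
    - (Num.sqrt 3 * x'%:~R + Num.sqrt 3 / 2 * y'%:~R)
  = Num.sqrt 3 * ((x - x')%:~R + (y - y')%:~R / 2) :> R.
  by rewrite !intrB; field.
rewrite exprMn s3 /sqdist.
rewrite !(intrD, intrM, intrB, intrN, exprnP, expr2, exprSz, expr0z) /=.
by case: c; case: c' => /=; field.
Qed.


Lemma sqdist_small x y c x' y' c' : sqdist x y c x' y' c' <= 3 ->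
  (x' = x - 1 \/ x' = x \/ x' = x + 1) /\ (y' = y - 1 \/ y' = y \/ y' = y + 1).
Proof.
rewrite /sqdist; move Ee: (_%:Z - _) => e; move Ea: (x' - x) => a.
move Eb: (y' - y) => b h.
have {}h : 3 * (2 * a + b) ^+ 2 + (3 * b + 2 * e) ^+ 2 <= 12.
  have -> : 3 * (2 * a + b) ^+ 2 + (3 * b + 2 * e) ^+ 2 =
      4 * (3 * (a ^+ 2 + a * b + b ^+ 2 + b * e) + e ^+ 2) by ring.
  by lia.
have e1 : -1 <= e <= 1 by rewrite -Ee; case: (c); case: (c').
have hb : -1 <= b <= 1.
  apply/andP; split; rewrite leNgt; apply/negP => hb.
    suff: 16 <= (3 * b + 2 * e) ^+ 2 by have := sqr_ge0 (2 * a + b); lia.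
    by nia.
  suff: 16 <= (3 * b + 2 * e) ^+ 2 by have := sqr_ge0 (2 * a + b); lia.
  by nia.
have ha : -1 <= a <= 1.
  have h2 := sqr_ge0 (3 * b + 2 * e).
  by apply/andP; split; rewrite leNgt; apply/negP => ?; nia.
by split; lia.
Qed.

Lemma lattice_inj x y c x' y' c' :
  lattice_point x y c = lattice_point x' y' c' :> R * R ->
  [/\ x = x', y = y' & c = c'].
Proof.
move=> h; have := eucl_dist_lattice x y c x' y' c'.
rewrite -h {1}/eucl_dist !subrr expr0n/= addr0 sqrtr0.
move=> /esym/eqP; rewrite sqrtr_eq0 -[0]/(0%:~R) ler_int => h0.
have [] := sqdist_small (le_trans h0 (isT : (0 : int) <= 3)).
move: h0; rewrite /sqdist; case: c {h}; case: c' => /= h0 ex ey; split=> //;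
  by case: ex h0 => [|[]] ->; case: ey => [|[]] ->; lia.
Qed.

Lemma sqdist_ge0 x y c x' y' c' : 0 <= sqdist x y c x' y' c'.
Proof.
rewrite leNgt; apply/negP => h.
have [] := sqdist_small (ltW (lt_trans h (isT : (0 : int) < 3))).
move: h; rewrite /sqdist; case: c; case: c' => /= h ex ey;
  by case: ex h => [|[]] ->; case: ey => [|[]] ->; lia.
Qed.

Lemma eucl_dist_le x y c x1 y1 c1 x2 y2 c2 :
  (eucl_dist (lattice_point x y c : R * R) (lattice_point x1 y1 c1) <=
   eucl_dist (lattice_point x y c : R * R) (lattice_point x2 y2 c2)) =
  (sqdist x y c x1 y1 c1 <= sqdist x y c x2 y2 c2).
Proof.
by rewrite !eucl_dist_lattice ler_sqrt ?ler_int// ler0z sqdist_ge0.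
Qed.

Lemma hex_neighbours x y c : let s : int := if c then -1 else 1 in
  [set w | nearest_neighbour hex_vertices (lattice_point x y c : R * R) w] =
  [set` [:: lattice_point x y (~~ c); lattice_point x (y - s) (~~ c);
            lattice_point (x + s) (y - s) (~~ c)]].
Proof.
move=> s; apply/seteqP; split => w /=; rewrite !inE.
  case=> _ [x' [y' [c' ->]]] wu /(_ (lattice_point x y (~~ c))).
  rewrite eucl_dist_le => h.
  have h1 : sqdist x y c x' y' c' <= 1.
    apply: le_trans (h _ _) _.
    - by exists x, y, (~~ c).
    - by move/lattice_inj => []; case: (c).
    - by rewrite /sqdist; case: (c); lia.
  have [] := sqdist_small (le_trans h1 (isT : (1 : int) <= 3)).
  have : ~ [/\ x' = x, y' = y & c' = c] by move=> [? ? ?]; subst.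
  move: h1; rewrite /sqdist /s {h wu s}.
  case: c; case: c' => /= h1 h2 ex ey;
    case: ex h1 h2 => [|[]] ->; case: ey => [|[]] -> h1 h2;
    first [by exfalso; lia | by exfalso; apply: h2 | idtac];
    by rewrite ?opprK eqxx ?orbT.
have nn x' y' : sqdist x y c x' y' (~~ c) = 1 ->
    nearest_neighbour hex_vertices (lattice_point x y c : R * R)
      (lattice_point x' y' (~~ c)).
  move=> h; split.
  - by exists x, y, c.
  - by exists x', y', (~~ c).
  - by move/lattice_inj => []; case: (c).
  move=> _ [x1 [y1 [c1 ->]]] ne; rewrite eucl_dist_le h leNgt; apply/negP => h1.
  apply: ne; have [] := sqdist_small (le_trans (ltW h1) (isT : (1 : int) <= 3)).
  move: h1; rewrite /sqdist {h s}; case: c; case: c1 => /= h1 ex ey;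
    case: ex h1 => [|[]] ->; case: ey => [|[]] -> h1;
    first [by exfalso; lia | by []].
by case/or3P => /eqP ->; apply: nn; rewrite /sqdist /s; case: (c); lia.
Qed.

Lemma tri_neighbours x y :
  [set w | nearest_neighbour tri_vertices (lattice_point x y false : R * R) w] =
  [set` [:: lattice_point (x + 1) y false; lattice_point (x - 1) y false;
            lattice_point x (y + 1) false; lattice_point x (y - 1) false;
            lattice_point (x + 1) (y - 1) false;
            lattice_point (x - 1) (y + 1) false]].
Proof.
apply/seteqP; split => w /=; rewrite !inE.
  case=> _ [x' [y' ->]] wu /(_ (lattice_point (x + 1) y false)).
  rewrite eucl_dist_le => h.
  have h1 : sqdist x y false x' y' false <= 3.
    apply: le_trans (h _ _) _.
    - by exists (x + 1), y.
    - by move/lattice_inj => []; lia.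
    - by rewrite /sqdist; lia.
  have [] := sqdist_small h1.
  have h2 : ~ (x' = x /\ y' = y) by move=> [? ?]; subst.
  move: h1 h2; rewrite /sqdist {h wu} => /= h1 h2 ex ey.
  case: ex h1 h2 => [|[]] ->; case: ey => [|[]] -> h1 h2;
    first [by exfalso; lia | by exfalso; apply: h2 | idtac];
    by rewrite eqxx ?orbT.
have nn x' y' : sqdist x y false x' y' false = 3 ->
    nearest_neighbour tri_vertices (lattice_point x y false : R * R)
      (lattice_point x' y' false).
  move=> h; split.
  - by exists x, y.
  - by exists x', y'.
  - by move/lattice_inj => [ex ey _]; move: h; rewrite ex ey /sqdist; lia.
  move=> _ [x1 [y1 ->]] ne; rewrite eucl_dist_le h leNgt; apply/negP => h1.
  apply: ne; have [] := sqdist_small (ltW h1).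
  move: h1; rewrite /sqdist {h} /= => h1 ex ey;
    case: ex h1 => [|[]] ->; case: ey => [|[]] -> h1;
    first [by exfalso; lia | by []].
by case/or4P => [|||/or3P[]] /eqP ->; apply: nn; rewrite /sqdist /=; lia.
Qed.

Lemma card_hex_neighbours (u : R * R) : hex_vertices u ->
  [set w | nearest_neighbour hex_vertices u w] #= `I_3.
Proof.
move=> [x [y [c ->]]]; rewrite hex_neighbours; apply: uniq_card => /=.
rewrite !inE !negb_or !andbT; do ?[apply/andP; split=> //];
  by apply/eqP => /lattice_inj[]; case: (c); lia.
Qed.

Lemma card_tri_neighbours (u : R * R) : tri_vertices u ->
  [set w | nearest_neighbour tri_vertices u w] #= `I_6.
Proof.
move=> [x [y ->]]; rewrite tri_neighbours; apply: uniq_card => /=.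
rewrite !inE !negb_or !andbT; do ?[apply/andP; split=> //];
  by apply/eqP => /lattice_inj[]; lia.
Qed.
Lemma finite_hex_edges u : finite_set [set w | (0 < hex_edges u w)%N].
Proof.
apply: (sub_finite_set (B := [set w | nearest_neighbour hex_vertices u w])).
  by move=> w; rewrite /= /hex_edges lt0b => /asboolP.
have [uV|uV] := pselect (hex_vertices u).
  by apply/finite_setP; exists 3; exact: card_hex_neighbours.
by rewrite (_ : [set w | _] = set0)// -subset0 => w [].
Qed.

Lemma finite_tri_loop_edges u :
  finite_set [set w | (0 < tri_loop_edges u w)%N].
Proof.
apply: (sub_finite_set
    (B := [set w | nearest_neighbour tri_vertices u w] `|` [set u])).
  move=> w; rewrite /= /tri_loop_edges addn_gt0 muln_gt0 !lt0b.
  by case/orP => [/asboolP|/asboolP[_ ->]]; [left|right].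
rewrite finite_setU; split; last exact: finite_set1.
have [uV|uV] := pselect (tri_vertices u).
  by apply/finite_setP; exists 6; exact: card_tri_neighbours.
by rewrite (_ : [set w | _] = set0)// -subset0 => w [].
Qed.

End lattices.

Section probability.
Context {R : realType}.

(* The support condition makes every moment integral below converge. *)
Definition is_spectral_density (V : choiceType) (m : V -> V -> nat) (v : V)
    (rho : probability R R) : Prop :=
  (exists2 K : set R, compact K & rho (~` K) = 0%E) /\
  forall k : nat, (\int[rho]_x (x ^+ k)%:E = (nb_closed_walks m v k)%:R%:E)%E.

Definition independent_rv d (Omega : measurableType d) (P : probability Omega R)
    (X Y : {RV P >-> R}) : Prop :=
  forall B C : set R, measurable B -> measurable C ->
  P (X @^-1` B `&` Y @^-1` C) = (P (X @^-1` B) * P (Y @^-1` C))%E.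

Definition rademacher d (Omega : measurableType d) (P : probability Omega R)
    (A : {RV P >-> R}) : Prop :=
  P (A @^-1` [set 1]) = (2^-1)%:E /\ P (A @^-1` [set -1]) = (2^-1)%:E.

Definition uniform_on d (Omega : measurableType d) (P : probability Omega R)
    (X : {RV P >-> R}) (a b : R) : Prop :=
  exists ab : a < b, forall B : set R, measurable B ->
    distribution P X B = uniform_prob ab B.

(* Weak convergence of the laws, tested on bounded continuous functions. *)
Definition cvg_in_distribution
    d (Omega : measurableType d) (P : probability Omega R)
    (Z : R -> Omega -> R)
    d' (Omega' : measurableType d') (Q : probability Omega' R)
    (W : {RV Q >-> R}) : Prop :=
  (forall b, measurable_fun setT (Z b)) /\
  forall f : R -> R, continuous f -> bounded_fun f ->
    ('E_P[f \o Z b] @[b --> +oo%R] --> 'E_Q[f \o W])%E.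

End probability.

(* Main.v *)
Require Import Defs.
From HB Require Import structures.
From mathcomp Require Import all_boot all_order all_algebra.
From mathcomp Require Import finmap.
From mathcomp Require Import all_classical all_reals all_analysis.
From mathcomp Require Import measurable_realfun.
From mathcomp Require Import ring lra zify.

(* With [phi (x, y) = x - beta * y], multiplying [cos (phi u * t)] by
   [Z t = 3 + 2 (cos t + cos (beta t) + cos ((1 + beta) t))] gives the sum of
   [cos (phi w * t)] over the neighbours [w] of [u] in the triangular lattice
   with loops, so [Z ^+ k] is a sum of cosines over the walks of length [k] from
   the origin.  The mean of [cos (a t)] on [0, b] tends to 0 unless [a = 0], and
   by irrationality [phi w = 0] only at the origin: the limit of the moments of
   [Z] counts the closed walks.  Two steps in the hexagonal lattice make one
   step in the triangular lattice with loops, closed hexagonal walks have even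
   length, and [Z >= 0], so the moments of [A * sqrt Z] converge as well.  All
   laws being carried by a common bounded interval, Weierstrass' theorem
   turns convergence of moments into convergence in distribution. *)

Set Implicit Arguments.
Unset Strict Implicit.
Unset Printing Implicit Defensive.
Import Order.TTheory GRing.Theory Num.Theory.
Import numFieldNormedType.Exports.

Local Open Scope classical_set_scope.
Local Open Scope ring_scope.

(** * Counting walks *)

(** The endpoints are independent because deleting the first step of a closed walk leaves an open
    one. [nb_walks m v v] is [nb_closed_walks m v] by conversion. *)
Definition nb_walks (V : choiceType) (m : V -> V -> nat) (u v : V) (k : nat) :
    nat :=
  #|` fset_set [set s | size s = k /\ is_walk m u s v]|%fset.

Lemma card_fset_set_seq (T : choiceType) (A : set T) (l : seq T) :
  uniq l -> (forall x, A x <-> x \in l) -> #|` fset_set A|%fset = size l.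
Proof.
move=> ul Al; have -> : A = [set` [fset x in l]%fset].
  by apply/seteqP; split=> x /=; rewrite in_fset => /Al.
by rewrite set_fsetK card_fseq undup_id.
Qed.

Lemma finite_walks (V : choiceType) (m : V -> V -> nat) (u v : V) (k : nat) :
  (forall w, finite_set [set w' | (0 < m w w')%N]) ->
  finite_set [set s | size s = k /\ is_walk m u s v].
Proof.
move=> mfin; elim: k u => [|k IHk] u.
  apply: (sub_finite_set (B := [set [::]])); last exact: finite_set1.
  by move=> s [/size0nil].
apply: (sub_finite_set (B := \bigcup_(w in [set w | (0 < m u w)%N])
    \bigcup_(e in `I_(m u w))
      (cons (w, e) @` [set s | size s = k /\ is_walk m w s v]))).
  case=> [|[w e] s] [//= [sk] [ew ws]].
  by exists w; [exact: leq_ltn_trans ew|exists e => //; exists s].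
apply: bigcup_finite => [|w _]; first exact: mfin.
by apply: bigcup_finite => [|e _]; [exact: finite_II|exact: finite_image].
Qed.

Lemma nb_walks0 (V : choiceType) (m : V -> V -> nat) (u v : V) :
  nb_walks m u v 0 = (u == v).
Proof.
rewrite /nb_walks (@card_fset_set_seq _ _ (if u == v then [:: [::]] else [::])).
- by case: (u == v).
- by case: (u == v).
by case=> [|p s]; case: eqVneq => [->|/eqP uv] //=; split=> // -[].
Qed.

(** Each walk splits into its first edge and the rest. The list [l] only has to contain the
    out-neighbours of [u], since any other entry has multiplicity [m u w = 0]. *)
Lemma nb_walksS (V : choiceType) (m : V -> V -> nat) (u v : V) (k : nat)
    (l : seq V) :
  (forall w, finite_set [set w' | (0 < m w w')%N]) ->
  uniq l -> (forall w, (0 < m u w)%N -> w \in l) ->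
  nb_walks m u v k.+1 = (\sum_(w <- l) m u w * nb_walks m w v k)%N.
Proof.
move=> mfin ul supp.
pose L w : seq (seq (V * nat)) :=
  fset_set [set s | size s = k /\ is_walk m w s v].
have LP w s : s \in L w <-> size s = k /\ is_walk m w s v.
  by rewrite in_fset_set ?inE//; exact: finite_walks.
pose we := [seq (w, e) | w <- l, e <- iota 0 (m u w)].
have uwe : uniq we.
  apply: allpairs_uniq_dep => // [w _|]; first exact: iota_uniq.
  by move=> [x1 x2] [y1 y2] _ _ /= [-> ->].
rewrite /nb_walks
  (@card_fset_set_seq _ _ [seq p :: s | p <- we, s <- L p.1]); last 2 first.
- apply: allpairs_uniq_dep => // [w _|]; first exact: fset_uniq.
  by move=> [x1 x2] [y1 y2] _ _ /= [-> ->].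
- move=> s; split.
    case: s => [|[w e] s] [//= [sk] [ew ws]].
    apply/allpairsPdep; exists (w, e), s; split=> //.
      apply/allpairsPdep; exists w, e; split=> //.
        by apply: supp; exact: leq_ltn_trans ew.
      by rewrite mem_iota.
    by apply/LP.
  move=> /allpairsPdep[[w e] [s' [/allpairsPdep[w' [e' [_ + [-> ->]]]] + ->]]].
  by rewrite mem_iota /= => /= e'm /LP[<-].
rewrite size_allpairs_dep sumnE big_map big_allpairs_dep.
apply: eq_bigr => w _ /=.
by rewrite big_const_seq count_predT size_iota iter_addn_0 mulnC.
Qed.

(** * Walk recursions on the two lattices *)

Section lattice_walks.
Context {R : realType}.
Local Notation pt := (@lattice_point R).

(* The steps of the triangular lattice with loops, in the coordinates [x], [y]
   of [lattice_point]. *)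
Definition tri_loop_steps : seq (int * int) :=
  [:: (0, 0); (0, 0); (0, 0); (1, 0); (- 1, 0); (0, 1); (0, - 1); (1, - 1);
      (- 1, 1)].

(** Walk counts on both lattices satisfy this, the hexagonal ones after doubling the length. The
    limit of the moments depends on [n] only through this recursion and the values at [k = 0]. *)
Definition tri_loop_recursion (n : int -> int -> nat -> nat) : Prop :=
  forall x y k, n x y k.+1 =
    (\sum_(p <- tri_loop_steps) n (x + p.1)%R (y + p.2)%R k)%N.

Lemma tri_loop_recursion_shift n x0 y0 : tri_loop_recursion n ->
  tri_loop_recursion (fun x y => n (x0 + x) (y0 + y)).
Proof. by move=> nS x y k; rewrite nS; under eq_bigr do rewrite -!addrA. Qed.

Lemma nb_walks_tri (v : R * R) :
  tri_loop_recursion (fun x y k => nb_walks tri_loop_edges (pt x y false) v k).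
Proof.
move=> x y k.
have S w : [set` [:: pt (x + 1) y false; pt (x - 1) y false;
    pt x (y + 1) false; pt x (y - 1) false; pt (x + 1) (y - 1) false;
    pt (x - 1) (y + 1) false]] w
    <-> nearest_neighbour tri_vertices (pt x y false) w.
  by rewrite -tri_neighbours.
(* A nearest neighbour differs from the base point, so the loop term of [tri_loop_edges] vanishes
   there. *)
have nn w : w \in [:: pt (x + 1) y false; pt (x - 1) y false;
    pt x (y + 1) false; pt x (y - 1) false; pt (x + 1) (y - 1) false;
    pt (x - 1) (y + 1) false] -> tri_loop_edges (pt x y false) w = 1%N.
  move=> wS; have /S wn : [set` [:: pt (x + 1) y false; pt (x - 1) y false;
    pt x (y + 1) false; pt x (y - 1) false; pt (x + 1) (y - 1) false;
    pt (x - 1) (y + 1) false]] w by [].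
  rewrite /tri_loop_edges (asboolT wn) asboolF// => -[_ uw].
  by case: wn => _ _; rewrite uw.
rewrite (@nb_walksS _ _ _ _ _ [:: pt x y false; pt (x + 1) y false;
    pt (x - 1) y false; pt x (y + 1) false; pt x (y - 1) false;
    pt (x + 1) (y - 1) false; pt (x - 1) (y + 1) false]).
- have loops : tri_loop_edges (pt x y false) (pt x y false) = 3%N.
    rewrite /tri_loop_edges asboolF; last by case=> _ _ /(_ erefl).
    by rewrite asboolT//; split=> //; exists x, y.
  rewrite !big_cons !big_nil loops !nn ?inE ?eqxx ?orbT//.
  by rewrite /= !addr0; ring.
- exact: finite_tri_loop_edges.
- rewrite /= !inE !negb_or !andbT; do ?[apply/andP; split=> //];
  by apply/eqP => /lattice_inj[]; lia.
- move=> w; rewrite /tri_loop_edges addn_gt0 muln_gt0 !lt0b in_cons.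
  by case/orP => [/asboolP/S /= ->|/asboolP[_ ->]]; rewrite ?eqxx ?orbT.
Qed.

Lemma nb_walks_hexS (v : R * R) x y c k : let s : int := if c then -1 else 1 in
  nb_walks hex_edges (pt x y c) v k.+1 =
  (nb_walks hex_edges (pt x y (~~ c)) v k
   + nb_walks hex_edges (pt x (y - s)%R (~~ c)) v k
   + nb_walks hex_edges (pt (x + s)%R (y - s)%R (~~ c)) v k)%N.
Proof.
move=> s.
pose l := [:: pt x y (~~ c); pt x (y - s) (~~ c); pt (x + s) (y - s) (~~ c)].
have S w : w \in l <-> nearest_neighbour hex_vertices (pt x y c) w.
  transitivity ([set` l] w) => //.
  by rewrite -[X in _ <-> X]/([set w | _] w) hex_neighbours.
rewrite (@nb_walksS _ _ _ _ _ l).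
- have nn w : w \in l -> hex_edges (pt x y c) w = 1%N.
    by move=> /S wn; rewrite /hex_edges asboolT.
  by rewrite !big_cons big_nil !nn ?inE ?eqxx ?orbT// !mul1n addn0 addnA.
- exact: finite_hex_edges.
- rewrite /= !inE !negb_or !andbT; do ?[apply/andP; split=> //];
  by apply/eqP => /lattice_inj[]; rewrite /s; case: (c); lia.
- by move=> w; rewrite /hex_edges lt0b => /asboolP/S.
Qed.

(* Two steps on the hexagonal lattice stay on one of its two triangular
   sublattices and make up one step of the triangular lattice with loops. *)
Lemma nb_walks_hex_double (v : R * R) c :
  tri_loop_recursion (fun x y k => nb_walks hex_edges (pt x y c) v k.*2).
Proof.
move=> x y k; rewrite doubleS !big_cons !big_nil !nb_walks_hexS !negbK /=.
case: c => /=;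
  rewrite ?addr0 ?opprK ?addrK ?subrK ?[_ - 1 + 1]subrK; ring.
Qed.

(** The hexagonal lattice is bipartite: every step flips [c]. *)
Lemma nb_walks_hex_parity x y c x0 y0 c0 k : c (+) c0 (+) odd k ->
  nb_walks hex_edges (pt x y c) (pt x0 y0 c0) k = 0%N.
Proof.
elim: k x y c => [|k IHk] x y c.
  rewrite nb_walks0 addbF; case: eqVneq => // /lattice_inj[_ _ ->].
  by rewrite addbb.
move=> h; rewrite nb_walks_hexS !IHk//;
  by move: h; rewrite /= addbN addNb addNb.
Qed.

End lattice_walks.

(** * Weierstrass' approximation theorem *)

Section bernstein.
Context {R : realType}.

(* [bern n g j] is the expectation of [g (j + B)], [B] binomial with
   parameters [n] and ['X]; for [j = 0] it is a Bernstein polynomial. *)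
Fixpoint bern (n : nat) (g : nat -> R) (j : nat) : {poly R} :=
  if n is n'.+1 then (1 - 'X) * bern n' g j + 'X * bern n' g j.+1
  else (g j)%:P.

Lemma bernS n g j (x : R) :
  (bern n.+1 g j).[x] = (1 - x) * (bern n g j).[x] + x * (bern n g j.+1).[x].
Proof. by rewrite /= !hornerE. Qed.

(** Positivity of the Bernstein operator: the weights [1 - x] and [x] are nonnegative on the unit
    interval. *)
Lemma le_bern n (g h : nat -> R) j (x : R) : 0 <= x <= 1 ->
  (forall i, (j <= i <= j + n)%N -> g i <= h i) ->
  (bern n g j).[x] <= (bern n h j).[x].
Proof.
move=> /andP[x0 x1]; elim: n j => [|n IHn] j gh.
  by rewrite /= !hornerE gh// addn0 leqnn.
rewrite !bernS lerD// ler_wpM2l ?subr_ge0//; apply: IHn => i ij; apply: gh; lia.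
Qed.

(** Squared bias plus variance: the binomial law shifted by [j] has mean [j + n x] and variance
    [n x (1 - x)]. *)
Lemma bern_sqr n (a c e : R) j (x : R) :
  (bern n (fun i => a + e * (i%:R - c) ^+ 2) j).[x] =
  a + e * ((j%:R + n%:R * x - c) ^+ 2 + n%:R * x * (1 - x)).
Proof.
elim: n j => [|n IHn] j; first by rewrite /= hornerE; ring.
by rewrite bernS !IHn !mulrS; ring.
Qed.

End bernstein.

Section weierstrass.
Context {R : realType}.

Lemma bounded_fun_leP (T : Type) (f : T -> R) :
  bounded_fun f <-> exists M, forall x, `|f x| <= M.
Proof.
split=> [[M [_ fM]]|[M fM]]; last first.
  exists M; split; first exact: num_real.
  by move=> N MN x _; rewrite /= (le_trans (fM x))// ltW.
by exists (M + 1) => x; apply: fM => //; rewrite ltrDl.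
Qed.

(** Heine-Cantor, with only [x] confined to the segment. *)
Lemma continuous_itv_unif (f : R -> R) (a b e : R) : continuous f -> 0 < e ->
  exists2 del, 0 < del & forall x y, a <= x <= b -> `|x - y| < del ->
    `|f x - f y| < e.
Proof.
move=> cf e0.
(* Compactness in near-covering form: if around each point all small radii work, then all small
   radii work on the whole segment at once. *)
have := (@segment_compact R a b); rewrite compact_near_coveringP.
move=> /(_ R (0 : R)^'+ (fun del x => forall y, `|x - y| < del ->
  `|f x - f y| < e) _) [].
  move=> x _.
  have /cvgrPdist_lt/(_ (e / 2)) := cf x; rewrite divr_gt0// => /(_ isT).
  rewrite near_simpl => /nbhs_ballP[r /= r0 rf].
  have r20 : 0 < r / 2 by rewrite divr_gt0.
  exists (ball x (r / 2), [set d | d < r / 2]).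
    split; first exact: nbhsx_ballx.
    exact: nbhs_right_lt.
  move=> [z d] /= [xz dr] y zy.
  have h1 : `|f x - f z| < e / 2.
    apply: rf; apply: le_ball xz; lra.
  have h2 : `|f x - f y| < e / 2.
    apply: rf; rewrite /ball/= in xz *.
    rewrite (_ : x - y = (x - z) + (z - y)); last by ring.
    by rewrite (le_lt_trans (ler_normD _ _))//; lra.
  rewrite (_ : f z - f y = (f x - f y) - (f x - f z)); last by ring.
  by rewrite (le_lt_trans (ler_normB _ _))//; lra.
(* Every radius strictly between 0 and [d] works; [d / 2] is one of them. *)
move=> d /= d0 h; exists (d / 2); first by rewrite divr_gt0.
move=> x y xab xy; apply: (h (d / 2)) => //=.
- by rewrite sub0r normrN ger0_norm; lra.
- by rewrite divr_gt0.
Qed.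

Lemma weierstrass01 (f : R -> R) (e : R) : continuous f -> bounded_fun f ->
  0 < e -> exists p : {poly R}, forall x, 0 <= x <= 1 -> `|f x - p.[x]| <= e.
Proof.
move=> cf /bounded_fun_leP[M fM] e0.
have e20 : 0 < e / 2 by rewrite divr_gt0.
have [del del0 fdel] := continuous_itv_unif 0 1 cf e20.
have {}fM y : `|f y| <= `|M| by rewrite (le_trans (fM y))// ler_norm.
(* Chosen so that [K * del ^+ 2 = 2 * |M|], which bounds [|f y - f x|] when [x] and [y] are at least
   [del] apart. *)
pose K := 2 * `|M| / del ^+ 2.
have K0 : 0 <= K by rewrite !mulr_ge0// invr_ge0 sqr_ge0.
(* Chebyshev's device: the variance of the binomial law bounds the error. *)
have fK x y : 0 <= x <= 1 -> `|f y - f x| <= e / 2 + K * (y - x) ^+ 2.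
  move=> x01; have [xy|xy] := ltP `|x - y| del.
    rewrite distrC (le_trans (ltW (fdel _ _ x01 xy)))// lerDl mulr_ge0//.
    exact: sqr_ge0.
  rewrite (le_trans (ler_normB _ _))//.
  have : 2 * `|M| <= K * (y - x) ^+ 2.
    rewrite /K -[leRHS]mulrA ler_peMr ?mulr_ge0//.
    rewrite mulrC ler_pdivlMr ?exprn_gt0// mul1r.
    rewrite -[leRHS]real_normK ?num_real// lerXn2r ?nnegrE ?(ltW del0)//.
    by rewrite distrC.
  by have := fM x; have := fM y; lra.
have [n nK] : exists n : nat, K / n.+1%:R <= e / 2.
  exists (Num.truncn (K / (e / 2))).
  rewrite ler_pdivrMr// mulrC -ler_pdivrMr// ltW//.
  by rewrite truncnS_gt ?divr_ge0// ltW.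
have n0 : 0 < n.+1%:R :> R by [].
exists (bern n.+1 (fun i => f (i%:R / n.+1%:R)) 0) => x x01.
pose B := e / 2 + K / n.+1%:R ^+ 2 * (n.+1%:R * x * (1 - x)).
have Be : B <= e.
  rewrite /B [leRHS]splitr lerD2l (le_trans _ nK)//.
  rewrite (_ : _ * _ = K / n.+1%:R * (x * (1 - x))); last first.
    by field; rewrite addrC natr1 lt0r_neq0.
  rewrite ler_piMr ?divr_ge0//; by nra.
(* For [a = f x] and [s = 1] or [s = -1] these are the quadratic majorant and minorant of [f] around
   [x]. Their centre is the binomial mean, so the bias vanishes and only the variance remains in
   [B]. *)
have E a s : (bern n.+1 (fun i =>
    a + s * (e / 2 + K * (i%:R / n.+1%:R - x) ^+ 2)) 0).[x] = a + s * B.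
  have -> : (fun i : nat => a + s * (e / 2 + K * (i%:R / n.+1%:R - x) ^+ 2)) =
      (fun i => (a + s * (e / 2))
        + s * (K / n.+1%:R ^+ 2) * (i%:R - n.+1%:R * x) ^+ 2).
    by apply/funext => i; field; rewrite lt0r_neq0.
  by rewrite bern_sqr add0r subrr expr0n/= add0r /B; ring.
have h1 : (bern n.+1 (fun i => f (i%:R / n.+1%:R)) 0).[x] <= f x + 1 * B.
  rewrite -E; apply: le_bern => // i _.
  have := fK x (i%:R / n.+1%:R) x01.
  by rewrite ler_norml mul1r => /andP[_]; rewrite lerBlDl.
have h2 : f x + -1 * B <= (bern n.+1 (fun i => f (i%:R / n.+1%:R)) 0).[x].
  rewrite -E; apply: le_bern => // i _.
  have := fK x (i%:R / n.+1%:R) x01.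
  by rewrite ler_norml mulN1r => /andP[+ _]; rewrite lerBrDl.
by rewrite ler_norml; lra.
Qed.

Lemma weierstrass (f : R -> R) (M e : R) : continuous f -> bounded_fun f ->
  0 < M -> 0 < e ->
  exists p : {poly R}, forall x, `|x| <= M -> `|f x - p.[x]| <= e.
Proof.
move=> cf bf M0 e0.
(* [h] maps the unit interval onto [-M, M]; the polynomial found for [f \o h] is composed with the
   inverse of [h]. *)
pose h (x : R) := 2 * M * x - M.
have ch : continuous h.
  move=> x; apply: cvgB; last exact: cvg_cst.
  by apply: cvgM; [exact: cvg_cst|exact: cvg_id].
have [||p hp] := @weierstrass01 (f \o h) e _ _ e0.
- by move=> x; apply: continuous_comp; [exact: ch|exact: cf].
- case/bounded_fun_leP: bf => C fC; apply/bounded_fun_leP; exists C => x.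
  exact: fC.
exists (p \Po ((2 * M)^-1%:P * ('X + M%:P))) => x xM.
rewrite horner_comp !hornerE.
have -> : f x = (f \o h) ((2 * M)^-1 * (x + M)).
  by rewrite /= /h; congr f; field; rewrite lt0r_neq0.
apply: hp; move: xM; rewrite ler_norml => /andP[x1 x2].
rewrite mulrC divr_ge0 ?ler_pdivrMr ?mulr_gt0//; lra.
Qed.
End weierstrass.

(** * Convergence of moments and convergence in distribution *)

(** Truncation to [-M, M] for [M >= 0]. It turns an almost sure bound into a pointwise one without
    changing integrals. *)
Definition clamp {R : realType} (M x : R) : R := Num.max (- M) (Num.min M x).

Section bounded_expectation.
Context {R : realType} d (Omega : measurableType d) (P : probability Omega R).
Implicit Types (g h U : Omega -> R) (M : R).

Lemma bounded_integrable g M : measurable_fun setT g ->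
  (forall w, `|g w| <= M) -> P.-integrable setT (EFin \o g).
Proof.
move=> mg gM; apply: measurable_bounded_integrable => //.
  by rewrite (le_lt_trans (probability_le1 _ _))// ltry.
by apply/bounded_fun_leP; exists M.
Qed.

Lemma Rintegral_dist_le g h (e : R) :
  P.-integrable setT (EFin \o g) -> P.-integrable setT (EFin \o h) ->
  (forall w, `|g w - h w| <= e) ->
  `|\int[P]_w g w - \int[P]_w h w| <= e.
Proof.
move=> ig ih gh.
have igh : P.-integrable setT (EFin \o (fun w => g w - h w)).
  by apply: eq_integrable (integrableB _ ig ih).
rewrite -RintegralB// (le_trans (le_normr_Rintegral _ igh))//.
have eE : \int[P]_w e = e.
  rewrite Rintegral_cst//.
  have -> : fine (P setT) = 1 by rewrite probability_setT.
  by rewrite mulr1.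
rewrite -[leRHS]eE.
apply: le_Rintegral => //.
- exact: integrable_norm.
- by apply: finite_measure_integrable_cst.
Qed.

Lemma ae_eq_Rintegral g h : measurable_fun setT g -> measurable_fun setT h ->
  {ae P, forall w, g w = h w} -> \int[P]_w g w = \int[P]_w h w.
Proof.
move=> mg mh gh; congr fine; apply: ae_eq_integral => //.
- exact/measurable_EFinP.
- exact/measurable_EFinP.
- by apply: filterS gh => w -> _.
Qed.

Lemma clamp_id M x : `|x| <= M -> clamp M x = x.
Proof. by rewrite ler_norml => /andP[x1 x2]; rewrite /clamp min_r// max_r. Qed.

Lemma norm_clamp M x : 0 <= M -> `|clamp M x| <= M.
Proof.
move=> M0; rewrite ler_norml /clamp le_max lexx/= ge_max ge_min lexx/=.
by rewrite andbT lerNl (le_trans _ M0)// oppr_le0.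
Qed.

Lemma continuous_clamp M : continuous (clamp M).
Proof.
move=> x; apply: (@continuous_max _ _ (cst (- M)) (cst M \min idfun)).
  exact: cvg_cst.
by apply: continuous_min; [exact: cvg_cst|exact: cvg_id].
Qed.

Lemma measurable_clamp M U : measurable_fun setT U ->
  measurable_fun setT (clamp M \o U).
Proof.
by apply: measurableT_comp; apply: continuous_measurable_fun;
  exact: continuous_clamp.
Qed.

Lemma Rintegral_clamp (f : R -> R) U M : measurable_fun setT f ->
  measurable_fun setT U -> {ae P, forall w, `|U w| <= M} ->
  \int[P]_w f (U w) = \int[P]_w f (clamp M (U w)).
Proof.
move=> mf mU UM; apply: ae_eq_Rintegral.
- exact: measurableT_comp.
- by apply: measurableT_comp => //; exact: measurable_clamp.
- by apply: filterS UM => w Uw; rewrite clamp_id.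
Qed.

Lemma bounded_horner_integrable U M (p : {poly R}) : measurable_fun setT U ->
  (forall w, `|U w| <= M) -> P.-integrable setT (EFin \o (fun w => p.[U w])).
Proof.
move=> mU UM.
apply: (@bounded_integrable _ (\sum_(i < size p) `|p`_i| * M ^+ i)).
  rewrite (_ : (fun w => p.[U w]) = horner p \o U)//.
  by apply: measurableT_comp => //; exact: measurable_poly.
move=> w; rewrite horner_coef (le_trans (ler_norm_sum _ _ _))//.
apply: ler_sum => i _; rewrite normrM normrX ler_wpM2l//.
by rewrite lerXn2r ?nnegrE// (le_trans _ (UM w)).
Qed.

Lemma Rintegral_horner U M (p : {poly R}) : measurable_fun setT U ->
  (forall w, `|U w| <= M) ->
  \int[P]_w p.[U w] = \sum_(i < size p) p`_i * \int[P]_w (U w ^+ i).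
Proof.
move=> mU UM.
(* The truncations of [p] allow an induction that adds one monomial at a time. *)
pose q n : {poly R} := \sum_(i < n) p`_i *: 'X^i.
have ip (r : {poly R}) : P.-integrable setT (EFin \o (fun w => r.[U w])).
  exact: bounded_horner_integrable mU UM.
suff qE n : \int[P]_w (q n).[U w] = \sum_(i < n) p`_i * \int[P]_w (U w ^+ i).
  by rewrite -qE /q -poly_def coefK.
elim: n => [|n IHn].
  rewrite /q !big_ord0; under eq_Rintegral do rewrite horner0.
  by rewrite Rintegral_cst// mul0r.
rewrite [RHS]big_ord_recr /= -IHn /q big_ord_recr /= -/(q n).
under eq_Rintegral do rewrite hornerD hornerZ hornerXn.
rewrite RintegralD//.
- rewrite RintegralZl//.
  by apply: eq_integrable (ip 'X^n) => // w _ /=; rewrite hornerXn.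
- by apply: eq_integrable (ip (p`_n *: 'X^n)) => // w _ /=;
    rewrite hornerZ hornerXn.
Qed.

End bounded_expectation.

Section moments.
Context {R : realType} d (Omega : measurableType d) (P : probability Omega R)
  d' (Omega' : measurableType d') (Q : probability Omega' R).

(** The method of moments under a common bound. Replacing [f] by a polynomial within [e / 3] of it
    on [-M, M] costs at most [e / 3] on each side, and the expectation of the polynomial is a finite
    combination of moments. *)
Lemma cvg_in_distribution_moments (Z : R -> Omega -> R) (W : {RV Q >-> R})
    (M : R) : 0 < M ->
  (forall b, measurable_fun setT (Z b)) ->
  (forall b, {ae P, forall w, `|Z b w| <= M}) ->
  {ae Q, forall w, `|W w| <= M} ->
  (forall k, \int[P]_w (Z b w ^+ k) @[b --> +oo] --> \int[Q]_w (W w ^+ k)) ->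
  cvg_in_distribution P Z W.
Proof.
move=> M0 mZ ZM WM mom; split=> // f cf bf.
have [C fC] : exists C, forall x, `|f x| <= C by apply/bounded_fun_leP.
have mf : measurable_fun setT f by exact: continuous_measurable_fun.
have mW : measurable_fun setT W by [].
have EE d0 (T0 : measurableType d0) (P0 : probability T0 R) (U : T0 -> R) :
    measurable_fun setT U -> 'E_P0[f \o U]%E = (\int[P0]_w f (U w))%:E.
  move=> mU; rewrite unlock fineK//; apply: integrable_fin_num => //.
  apply: (@bounded_integrable _ _ _ P0 _ C); first exact: measurableT_comp.
  by move=> w; exact: fC.
rewrite EE//; apply: cvg_EFin; first by near=> b; rewrite EE.
rewrite (_ : fine \o _ = fun b => \int[P]_w f (Z b w)); last first.
  by apply/funext => b /=; rewrite EE.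
have M0' := ltW M0.
apply/cvgrPdist_le => e e0.
have e30 : 0 < e / 3 by rewrite divr_gt0.
have [p fp] := weierstrass cf bf M0 e30.
have approx d0 (T0 : measurableType d0) (P0 : probability T0 R) (U : T0 -> R) :
    measurable_fun setT U -> {ae P0, forall w, `|U w| <= M} ->
    `|\int[P0]_w f (U w) - \sum_(i < size p) p`_i * \int[P0]_w (U w ^+ i)|
      <= e / 3.
  move=> mU UM; have mcU := measurable_clamp M mU.
  have cUM w : `|clamp M (U w)| <= M by exact: norm_clamp.
  rewrite (Rintegral_clamp mf mU UM).
  under eq_bigr do rewrite (Rintegral_clamp (exprn_measurable _) mU UM).
  rewrite -(Rintegral_horner P0 p mcU cUM).
  apply: Rintegral_dist_le => [||w]; last exact: fp.
  - apply: (@bounded_integrable _ _ _ P0 _ C); first exact: measurableT_comp.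
    by move=> w; exact: fC.
  - exact: bounded_horner_integrable mcU cUM.
have : \sum_(i < size p) p`_i * \int[P]_w (Z b w ^+ i) @[b --> +oo]
    --> \sum_(i < size p) p`_i * \int[Q]_w (W w ^+ i).
  apply: cvg_big => [|i _]; first exact: add_continuous.
  by apply: cvgM; [exact: cvg_cst|exact: mom].
move=> /cvgrPdist_le/(_ _ e30) near_p.
near=> b.
have h1 := approx _ _ Q _ mW WM.
have h2 := approx _ _ P _ (mZ b) (ZM b).
have h3 : `|\sum_(i < size p) p`_i * \int[Q]_w (W w ^+ i) -
  \sum_(i < size p) p`_i * \int[P]_w (Z b w ^+ i)| <= e / 3 by near: b.
move: h1 h2 h3; rewrite !ler_norml; lra.
Unshelve. all: by end_near. Qed.

End moments.

(** * Trigonometric means *)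

Section uniform.
Context {R : realType}.

(* The library gives [uniform_prob] on [measurableTypeR R], whose display is
   not the one of the canonical measurable structure of [R]. *)
Let idTR : measurableTypeR R -> R := idfun.

#[local] HB.instance Definition _ :=
  @isMeasurableFun.Build _ _ _ _ idTR (@measurable_id _ _ setT).

Lemma ge0_integral_uniform_on d (Omega : measurableType d)
    (P : probability Omega R) (U : {RV P >-> R}) (a b : R) (f : R -> \bar R) :
  measurable_fun setT f -> (forall x, 0 <= f x)%E -> uniform_on U a b ->
  (\int[P]_w f (U w) =
   (b - a)^-1%:E * \int[lebesgue_measure]_(x in `[a, b]) f x)%E.
Proof.
move=> mf f0 [ab Uunif]; rewrite -(integral_uniform ab mf f0).
(* Both integrals are rewritten over laws, the only objects that [uniform_on] compares. *)
pose V : {RV (uniform_prob ab) >-> R} := idTR.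
transitivity (\int[distribution P U]_x f x)%E.
  by rewrite ge0_integral_distribution.
transitivity (\int[distribution (uniform_prob ab) V]_x f x)%E.
  by apply: eq_measure_integral => B mB _; exact: Uunif.
by rewrite ge0_integral_distribution.
Qed.

End uniform.

Section trigonometric_means.
Context {R : realType}.
Implicit Types (beta t a : R) (x y : int).

(** The minus sign gives the diagonal step (1, -1) the frequency [1 + beta]. *)
Definition frequency beta x y : R := x%:~R - beta * y%:~R.

(** The sum of [cos (phi p * t)] over the nine entries [p] of [tri_loop_steps], with [phi] the
    frequency: the loops give 3, and each pair of opposite steps gives twice a cosine. *)
Definition tri_symbol beta t : R :=
  3 + 2 * (cos t + cos (beta * t) + cos ((1 + beta) * t)).

(** The right side is the squared modulus of $1 + e^{it} + e^{-i\beta t}$; this yields the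
    nonnegativity that the square root requires. *)
Lemma tri_symbolE beta t : tri_symbol beta t =
  (1 + cos t + cos (beta * t)) ^+ 2 + (sin t - sin (beta * t)) ^+ 2.
Proof.
have h1 := cos2Dsin2 t; have h2 := cos2Dsin2 (beta * t).
rewrite /tri_symbol (_ : (1 + beta) * t = t + beta * t); last by ring.
by rewrite cosD; lra.
Qed.

Lemma tri_symbol_ge0 beta t : 0 <= tri_symbol beta t.
Proof. by rewrite tri_symbolE addr_ge0// sqr_ge0. Qed.

Lemma tri_symbol_le9 beta t : tri_symbol beta t <= 9.
Proof.
have h1 := cos_le1 t; have h2 := cos_le1 (beta * t).
by have h3 := cos_le1 ((1 + beta) * t); rewrite /tri_symbol; lra.
Qed.

Lemma norm_tri_symbol beta t : `|tri_symbol beta t| <= 9.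
Proof. by rewrite ger0_norm ?tri_symbol_le9// tri_symbol_ge0. Qed.

Lemma continuous_cosZ a : continuous (fun t => cos (a * t)).
Proof.
move=> t; apply: continuous_comp; last exact: continuous_cos.
by apply: cvgM; [exact: cvg_cst|exact: cvg_id].
Qed.

Lemma continuous_tri_symbol beta : continuous (tri_symbol beta).
Proof.
move=> t; apply: cvgD; first exact: cvg_cst.
apply: cvgM; first exact: cvg_cst.
apply: cvgD; last exact: continuous_cosZ.
by apply: cvgD; [exact: continuous_cos|exact: continuous_cosZ].
Qed.

Lemma cosDcosB (a b : R) : cos (a + b) + cos (a - b) = 2 * cos b * cos a.
Proof. by rewrite cosD cosB; ring. Qed.

Lemma tri_symbol_step beta x y t :
  tri_symbol beta t * cos (frequency beta x y * t) =
  \sum_(p <- tri_loop_steps) cos (frequency beta (x + p.1) (y + p.2) * t).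
Proof.
rewrite !big_cons big_nil /= !addr0 /frequency !intrD !intrN !mulr1z.
set f := x%:~R - beta * y%:~R.
have -> : (x%:~R + 1 - beta * y%:~R) * t = f * t + t by rewrite /f; ring.
have -> : (x%:~R - 1 - beta * y%:~R) * t = f * t - t by rewrite /f; ring.
have -> : (x%:~R - beta * (y%:~R + 1)) * t = f * t - beta * t.
  by rewrite /f; ring.
have -> : (x%:~R - beta * (y%:~R - 1)) * t = f * t + beta * t.
  by rewrite /f; ring.
have -> : (x%:~R + 1 - beta * (y%:~R - 1)) * t = f * t + (1 + beta) * t.
  by rewrite /f; ring.
have -> : (x%:~R - 1 - beta * (y%:~R + 1)) * t = f * t - (1 + beta) * t.
  by rewrite /f; ring.
have h1 := cosDcosB (f * t) t; have h2 := cosDcosB (f * t) (beta * t).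
have h3 := cosDcosB (f * t) ((1 + beta) * t).
by rewrite /tri_symbol; lra.
Qed.

(** A zero with [y != 0] would give [beta = x / y], contradicting irrationality. *)
Lemma frequency_eq0 beta x y : irrational beta ->
  (frequency beta x y == 0) = (x == 0) && (y == 0).
Proof.
move=> irr; apply/idP/andP => [/eqP xy|[/eqP -> /eqP ->]]; last first.
  by rewrite /frequency mulr0 subrr.
have [y0|y0] := eqVneq y 0.
  by move: xy; rewrite /frequency y0 mulr0 subr0 => /eqP; rewrite intr_eq0.
exfalso; apply: irr; exists (x%:Q / y%:Q) => //.
have yR : y%:~R != 0 :> R by rewrite intr_eq0.
rewrite fmorph_div/= !ratr_int; apply: (mulIf yR); rewrite divfK//.
by move: xy; rewrite /frequency; lra.
Qed.

(** The added 1 makes the integrand nonnegative, as [ge0_integral_uniform_on] requires; it is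
    cancelled in [Rintegral_cosZ_uniform]. *)
Lemma integral_onem_cosZ a (b : R) : 0 < b -> a != 0 ->
  (\int[lebesgue_measure]_(t in `[0%R, b]) (1 + cos (a * t))%:E =
   (b + sin (a * b) / a)%:E)%E.
Proof.
move=> b0 a0; pose F t := t + a^-1 * sin (a * t).
have dF t : is_derive t 1 F (1 + cos (a * t)).
  have da : is_derive t 1 (fun t => a * t) a.
    by apply: is_derive_eq; rewrite /GRing.scale/= mulr1.
  have := is_derive1_comp (is_derive_sin (a * t)) da.
  move=> ds; rewrite /F; apply: is_derive_eq; rewrite /GRing.scale/=.
  by field.
have cF : continuous F.
  by move=> t; apply: differentiable_continuous; apply/derivable1_diffP.
rewrite (@continuous_FTC2 _ _ F 0 b)//.
- by rewrite -EFinB /F mulr0 sin0 mulr0 addr0 subr0 [a^-1 * _]mulrC.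
- apply: continuous_subspaceT => t.
  by apply: cvgD; [exact: cvg_cst|exact: continuous_cosZ].
- split.
  + by move=> t _.
  + by apply: cvg_at_right_filter; exact: cF.
  + by apply: cvg_at_left_filter; exact: cF.
- by move=> t _; rewrite derive1E derive_val.
Qed.

Context d (Omega : measurableType d) (P : probability Omega R).

Lemma Rintegral_cosZ_uniform (U : {RV P >-> R}) a (b : R) : 0 < b -> a != 0 ->
  uniform_on U 0 b -> \int[P]_w cos (a * U w) = sin (a * b) / (a * b).
Proof.
move=> b0 a0 Uunif.
have mc : measurable_fun setT (fun t : R => cos (a * t)).
  by apply: continuous_measurable_fun; exact: continuous_cosZ.
have mc1 : measurable_fun setT (fun t : R => (1 + cos (a * t))%:E).
  by apply/measurable_EFinP; apply: measurable_funD.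
have c0 t : (0 <= (1 + cos (a * t))%:E)%E.
  by rewrite lee_fin; have := cos_geN1 (a * t); lra.
have iE : (\int[P]_w (1 + cos (a * U w))%:E = (1 + sin (a * b) / (a * b))%:E)%E.
  rewrite (ge0_integral_uniform_on mc1 c0 Uunif) integral_onem_cosZ// -EFinM.
  congr EFin.
  by field; rewrite a0 lt0r_neq0.
have icos : P.-integrable setT (EFin \o (fun w => cos (a * U w))).
  apply: (@bounded_integrable _ _ _ _ _ 1); last by move=> w; exact: cos_max.
  exact: (measurableT_comp mc).
have : \int[P]_w (1 + cos (a * U w)) = 1 + sin (a * b) / (a * b).
  by rewrite /Rintegral iE.
rewrite RintegralD//; last exact: finite_measure_integrable_cst.
rewrite Rintegral_cst//.
have -> : fine (P setT) = 1 by rewrite probability_setT.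
by rewrite mulr1 => /addrI.
Qed.

Lemma cvg_sinZ_divZ a : a != 0 -> sin (a * b) / (a * b) @[b --> +oo] --> 0.
Proof.
move=> a0; apply/cvgrPdist_le => e e0; near=> b.
have b0 : 0 < b by near: b; apply: nbhs_pinfty_gt; exact: num_real.
have abe : (`|a| * e)^-1 <= b.
  by near: b; apply: nbhs_pinfty_ge; exact: num_real.
rewrite sub0r normrN normrM normfV normrM (gtr0_norm b0).
rewrite ler_pdivrMr ?mulr_gt0 ?normr_gt0//.
rewrite (le_trans (sin_max _))// mulrA [e * _]mulrC.
by rewrite -ler_pdivrMl ?mulr1// mulr_gt0// normr_gt0.
Unshelve. all: by end_near. Qed.

Lemma cvg_mean_cos beta (X : R -> {RV P >-> R}) x y : irrational beta ->
  (forall b, 0 < b -> uniform_on (X b) 0 b) ->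
  \int[P]_w cos (frequency beta x y * X b w) @[b --> +oo] -->
  (((x == 0) && (y == 0))%:R : R).
Proof.
move=> irr Xunif; rewrite -(frequency_eq0 x y irr).
case: eqVneq => [->|a0].
  under eq_fun do under eq_Rintegral do rewrite mul0r cos0.
  under eq_fun do rewrite Rintegral_cst// mul1r.
  have -> : fine (P setT) = 1 by rewrite probability_setT.
  exact: cvg_cst.
(* The closed formula is available for [b > 0], hence eventually. *)
apply: cvg_trans (cvg_sinZ_divZ a0); apply: near_eq_cvg; near=> b.
have b0 : 0 < b by near: b; apply: nbhs_pinfty_gt; exact: num_real.
by rewrite (Rintegral_cosZ_uniform b0 a0)//; exact: Xunif.
Unshelve. all: by end_near. Qed.

Lemma Rintegral_sum (I : Type) (s : seq I) (g : I -> Omega -> R) :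
  (forall i, P.-integrable setT (EFin \o g i)) ->
  \int[P]_w (\sum_(i <- s) g i w) = \sum_(i <- s) \int[P]_w g i w.
Proof.
move=> ig; elim: s => [|i s IHs].
  rewrite big_nil; under eq_Rintegral do rewrite big_nil.
  by rewrite Rintegral_cst// mul0r.
rewrite big_cons -IHs; under eq_Rintegral do rewrite big_cons.
rewrite RintegralD//.
apply: eq_integrable (integrable_sum measurableT s (fun i _ => ig i)) => //.
by move=> w _ /=; rewrite sumEFin.
Qed.

(* One factor [tri_symbol] moves the frequency by one step of the lattice, as
   one step of a walk does. *)
Lemma cvg_mean_tri_symbol beta (X : R -> {RV P >-> R}) n : irrational beta ->
  (forall b, 0 < b -> uniform_on (X b) 0 b) ->
  tri_loop_recursion n -> (forall x y, n x y 0 = (x == 0) && (y == 0) :> nat) ->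
  forall k x y,
  \int[P]_w (tri_symbol beta (X b w) ^+ k * cos (frequency beta x y * X b w))
    @[b --> +oo] --> ((n x y k)%:R : R).
Proof.
move=> irr Xunif nS n0; elim=> [|k IHk] x y.
  under eq_fun do under eq_Rintegral do rewrite expr0 mul1r.
  by rewrite n0; exact: cvg_mean_cos.
rewrite nS natr_sum.
under eq_fun => b.
  under eq_Rintegral do rewrite exprSr -mulrA tri_symbol_step mulr_sumr.
  rewrite Rintegral_sum; first over.
  move=> p; apply: (@bounded_integrable _ _ _ _ _ (9 ^+ k)).
    apply: (@measurableT_comp _ _ _ _ _ _ (fun t => tri_symbol beta t ^+ k *
      cos (frequency beta (x + p.1) (y + p.2) * t))) => //.
    apply: measurable_funM; last first.
      by apply: continuous_measurable_fun; exact: continuous_cosZ.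
    apply: measurable_funX; apply: continuous_measurable_fun.
    exact: continuous_tri_symbol.
  move=> w; rewrite normrM normrX -[leRHS]mulr1.
  apply: ler_pM => //; last exact: cos_max.
  by rewrite lerXn2r ?nnegrE// norm_tri_symbol.
apply: cvg_big => [|p _]; first exact: add_continuous.
exact: IHk.
Qed.

End trigonometric_means.

(** * Moments of a variable whose law is a spectral density *)

Section spectral.
Context {R : realType} d (Omega : measurableType d) (P : probability Omega R).

Lemma spectral_density_moments (V : choiceType) (m : V -> V -> nat) (v : V)
    (U : {RV P >-> R}) : is_spectral_density m v (distribution P U) ->
  (exists M, {ae P, forall w, `|U w| <= M}) /\
  forall k, \int[P]_w (U w ^+ k) = (nb_walks m v v k)%:R.
Proof.
move=> [[K cK K0] mom].
have mK : measurable (~` K).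
  by apply: measurableC; apply: closed_measurable; apply: compact_closed.
have [M [_ KM]] := compact_bounded cK.
(* [compact_bounded] only provides bounds strictly above [M], hence [M + 1]. *)
have UM : {ae P, forall w, `|U w| <= M + 1}.
  exists (U @^-1` (~` K)); split; [|exact: K0|].
  - by rewrite -[X in measurable X]setTI; exact: measurable_funP.
  - move=> w /= Uw Kw; apply: Uw; apply: (KM (M + 1)) => //.
    by rewrite ltrDl.
split; first by exists (M + 1).
move=> k; pose N := Num.max 0 (M + 1).
have N0 : 0 <= N by rewrite le_max lexx.
have UN : {ae P, forall w, `|U w| <= N}.
  by apply: filterS UM => w h; rewrite le_max h orbT.
have mX : measurable_fun setT (fun x : R => x ^+ k) by exact: exprn_measurable.
have mcX : measurable_fun setT (fun x : R => (clamp N x ^+ k)%:E).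
  apply/measurable_EFinP; apply: measurable_funX.
  by apply: (@measurable_clamp _ _ _ N idfun); exact: measurable_id.
rewrite (Rintegral_clamp mX _ UN)//.
(* Clamping makes the integrand bounded, hence integrable, so its integral can be moved from [U] to
   the law; there the clamp disappears because the law is carried by [K]. *)
have icX : P.-integrable setT (EFin \o (fun w => clamp N (U w) ^+ k)).
  apply: (@bounded_integrable _ _ _ P _ (N ^+ k)).
    by apply: measurable_funX; exact: measurable_clamp.
  by move=> w; rewrite normrX lerXn2r ?nnegrE// norm_clamp.
rewrite /Rintegral.
have -> : (\int[P]_w (clamp N (U w) ^+ k)%:E)%E =
    (\int[distribution P U]_x (clamp N x ^+ k)%:E)%E.
  by rewrite (integral_distribution mcX icX).
have -> : (\int[distribution P U]_x (clamp N x ^+ k)%:E)%E =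
    (\int[distribution P U]_x (x ^+ k)%:E)%E.
  apply: ae_eq_integral => //; first exact/measurable_EFinP.
  exists (~` K); split=> // x /= xK Kx; apply: xK => _.
  rewrite clamp_id// le_max; apply/orP; right.
  by apply: (KM (M + 1)) => //; rewrite ltrDl.
by rewrite mom.
Qed.

End spectral.

(** * Independence and the Rademacher sign *)

Section rademacher.
Context {R : realType} d (Omega : measurableType d) (P : probability Omega R).

(** The law of [U] under [P] restricted to [D] is [p] times the law of [U], by the product formula;
    [g] is then integrated against both measures. *)
Lemma ge0_integral_indep (D : set Omega) (mD : measurable D) (p : R)
    (U : {RV P >-> R}) (g : R -> \bar R) :
  0 <= p ->
  (forall B, measurable B -> P (D `&` U @^-1` B) = (p%:E * P (U @^-1` B))%E) ->
  measurable_fun setT g -> (forall x, 0 <= g x)%E ->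
  (\int[P]_(w in D) g (U w) = p%:E * \int[P]_w g (U w))%E.
Proof.
move=> p0 indep mg g0.
have mgU : measurable_fun setT (g \o U) by exact: measurableT_comp.
have restrE : (\int[mrestr P mD]_w g (U w) = \int[P]_(w in D) g (U w))%E.
  rewrite -(setUv D) ge0_integral_setU//=.
  - rewrite [X in (_ + X)%E](_ : _ = 0%E) ?adde0; last first.
      rewrite (@eq_measure_integral _ _ _ _ mzero) ?integral_measure_zero//.
      by move=> B mB BD; rewrite /= /mrestr (_ : _ `&` _ = set0) ?measure0//;
        apply/seteqP; split=> // x [/BD].
    apply: eq_measure_integral => B mB BD /=.
    by rewrite /mrestr setIidl.
  - exact: measurableC.
  - by rewrite setUv; exact: mgU.
  - by rewrite disj_set2E setICr.
rewrite -restrE.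
transitivity (\int[pushforward (mrestr P mD) U]_x g x)%E.
  by rewrite ge0_integral_pushforward.
transitivity (\int[mscale (NngNum p0) (distribution P U)]_x g x)%E; last first.
  by rewrite ge0_integral_mscale// ge0_integral_distribution.
apply: eq_measure_integral => B mB _.
by rewrite /= /pushforward /mrestr /mscale/= setIC indep.
Qed.

(** The two atoms already carry total mass 1. *)
Lemma rademacher_ae (A : {RV P >-> R}) : rademacher A ->
  {ae P, forall w, A w = 1 \/ A w = - 1}.
Proof.
move=> A_rad; pose D e := A @^-1` [set e].
have mD e : measurable (D e).
  by rewrite -[X in measurable X]setTI; exact: measurable_funP.
have [D1 DN1] : P (D 1) = (2^-1)%:E /\ P (D (- 1)) = (2^-1)%:E := A_rad.
exists (~` (D 1 `|` D (- 1))); split.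
- by apply: measurableC; exact: measurableU.
- have D0 : D 1 `&` D (- 1) = set0.
    by apply/seteqP; split=> // w; rewrite /D/= => -[->]; lra.
  have D1N1 : P (D 1 `|` D (- 1)) = 1%E.
    transitivity (P (D 1%R) + P (D (- 1)%R))%E; first exact: measureU.
    by rewrite D1 DN1 -EFinD; congr EFin; lra.
  have := probability_setC P (measurableU _ _ (mD 1) (mD (- 1))).
  by rewrite D1N1 subee.
- by move=> w /= Aw; apply: contra_not Aw.
Qed.

(** By independence the events [A = 1] and [A = -1] each contribute half the mean of [g (U w)], with
    opposite signs as [k] is odd. *)
Lemma Rintegral_rademacher_odd (A U : {RV P >-> R}) (g : R -> R) (M : R) k :
  rademacher A -> independent_rv A U -> measurable_fun setT g ->
  (forall x, 0 <= g x) -> (forall x, g x <= M) -> odd k ->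
  \int[P]_w (A w ^+ k * g (U w)) = 0.
Proof.
move=> A_rad indep mg g0 gM kodd.
pose D e := A @^-1` [set e].
have mD e : measurable (D e).
  by rewrite -[X in measurable X]setTI; exact: measurable_funP.
have mgU : measurable_fun setT (g \o U) by exact: measurableT_comp.
have igU : P.-integrable setT (EFin \o (g \o U)).
  apply: (@bounded_integrable _ _ _ P _ M) => // w.
  by rewrite /= ger0_norm.
have mgD e : measurable_fun setT ((g \o U) \_ (D e)).
  by apply/measurable_restrict => //; rewrite setTI; exact: measurable_funTS.
have igD e : P.-integrable setT (EFin \o ((g \o U) \_ (D e))).
  apply: (@bounded_integrable _ _ _ P _ M) => // w.
  rewrite patchE; case: ifP => _ /=; first by rewrite ger0_norm.
  by rewrite normr0 (le_trans (g0 0)).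
have half e : P (D e) = (2^-1)%:E ->
    \int[P]_w ((g \o U) \_ (D e)) w = 2^-1 * \int[P]_w g (U w).
  move=> De; rewrite -Rintegral_mkcond {1}/Rintegral.
  rewrite (@ge0_integral_indep _ (mD e) 2^-1 U (EFin \o g)) ?invr_ge0//.
  - by rewrite fineM//; exact: integrable_fin_num.
  - move=> B mB; rewrite -De; exact: indep.
  - exact/measurable_EFinP.
have [D1 DN1] : P (D 1) = (2^-1)%:E /\ P (D (- 1)) = (2^-1)%:E := A_rad.
transitivity (\int[P]_w (((g \o U) \_ (D 1)) w - ((g \o U) \_ (D (- 1))) w)).
  apply: ae_eq_Rintegral.
  - by apply: measurable_funM => //; exact: measurable_funX.
  - exact: measurable_funB.
  - apply: filterS (rademacher_ae A_rad) => w Aw.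
    have N11 : (1 == -1 :> R) = false.
      by apply/eqP => h; move: (@ltr01 R); rewrite {1}h; lra.
    rewrite !patchE /D; case: Aw => Aw.
    + rewrite mem_set//= memNset/= ?Aw ?expr1n ?mul1r ?subr0//.
      by apply/eqP; rewrite N11.
    + rewrite memNset/=; last by rewrite Aw => /esym/eqP; rewrite N11.
      by rewrite mem_set//= Aw -signr_odd kodd expr1 mulN1r sub0r.
by rewrite RintegralB// !half// subrr.
Qed.

End rademacher.

(** * Convergence of the moments and conclusion *)

Lemma lattice_point_shift_eq (R : realType) x0 y0 c x y :
  (lattice_point (x0 + x) (y0 + y) c == lattice_point x0 y0 c :> R * R) =
  (x == 0) && (y == 0).
Proof.
apply/eqP/andP => [/lattice_inj[+ + _]|[/eqP-> /eqP->]]; last by rewrite !addr0.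
by lia.
Qed.

(** [j k] is the number of steps of [m] matching [k] factors of the symbol: [id] serves the
    triangular lattice, [double] the hexagonal one. The shift by (x0, y0) puts the endpoint at the
    origin. *)
Lemma cvg_tri_symbol_moments (R : realType) (beta : R) d
    (Omega : measurableType d) (P : probability Omega R) (X : R -> {RV P >-> R})
    (m : R * R -> R * R -> nat) x0 y0 c (j : nat -> nat) :
  irrational beta -> (forall b, 0 < b -> uniform_on (X b) 0 b) -> j 0%N = 0%N ->
  tri_loop_recursion (fun x y k =>
    nb_walks m (lattice_point x y c) (lattice_point x0 y0 c) (j k)) ->
  forall k, \int[P]_w (tri_symbol beta (X b w) ^+ k) @[b --> +oo] -->
    ((nb_walks m (lattice_point x0 y0 c) (lattice_point x0 y0 c) (j k))%:R : R).
Proof.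
move=> irr Xunif j0 rec k.
have n0 x y : nb_walks m (lattice_point (x0 + x) (y0 + y) c)
    (lattice_point x0 y0 c) (j 0) = (x == 0) && (y == 0) :> nat.
  by rewrite j0 nb_walks0 lattice_point_shift_eq.
have := cvg_mean_tri_symbol irr Xunif (tri_loop_recursion_shift x0 y0 rec) n0.
(* At the origin the frequency is 0 and the cosine factor is 1. *)
move=> /(_ k 0 0); rewrite !addr0.
under eq_fun do under eq_Rintegral do
  rewrite /frequency mulr0 subrr mul0r cos0 mulr1.
exact.
Qed.

Theorem theorem3 (R : realType) (beta : R)
  (beta_gt0 : 0 < beta) (beta_irr : irrational beta)
  (d : measure_display) (Omega : measurableType d) (P : probability Omega R)
  (X : R -> {RV P >-> R}) (A : {RV P >-> R})
  (X_unif : forall b, 0 < b -> uniform_on (X b) 0 b)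
  (A_rad : rademacher A)
  (A_indep : forall b, 0 < b -> independent_rv A (X b))
  (vT vH : R * R) (vT_vertex : tri_vertices vT) (vH_vertex : hex_vertices vH)
  (dT : measure_display) (OmegaT : measurableType dT)
  (PT : probability OmegaT R) (T : {RV PT >-> R})
  (T_law : is_spectral_density tri_loop_edges vT (distribution PT T))
  (dH : measure_display) (OmegaH : measurableType dH)
  (PH : probability OmegaH R) (H : {RV PH >-> R})
  (H_law : is_spectral_density hex_edges vH (distribution PH H)) :
  let Y b omega :=
    cos (X b omega) + cos (beta * X b omega) + cos ((1 + beta) * X b omega) in
  cvg_in_distribution P (fun b omega => 3 + 2 * Y b omega) T /\
  cvg_in_distribution P
    (fun b omega => A omega * Num.sqrt (3 + 2 * Y b omega)) H.
Proof.
move=> Y.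
have ZE b omega : 3 + 2 * Y b omega = tri_symbol beta (X b omega) by [].
have ms : measurable_fun setT (tri_symbol beta).
  by apply: continuous_measurable_fun; exact: continuous_tri_symbol.
have mZ b : measurable_fun setT (fun omega => 3 + 2 * Y b omega).
  exact: (measurableT_comp ms).
split.
  have [x0 [y0 vTE]] := vT_vertex.
  have [[M TM] momT] := spectral_density_moments T_law.
  (* 9 bounds the symbol, [M] bounds [T] almost surely. *)
  apply: (@cvg_in_distribution_moments _ _ _ _ _ _ _ _ _ (Num.max 9 M)).
  - by rewrite lt_max ltr0n.
  - exact: mZ.
  - by move=> b; apply: aeW => w; rewrite le_max ZE norm_tri_symbol.
  - by apply: filterS TM => w h; rewrite le_max h orbT.
  - move=> k; rewrite momT vTE.
    exact: (cvg_tri_symbol_moments (j := id) beta_irr X_unif erefl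
      (nb_walks_tri _)).
have [x0 [y0 [c vHE]]] := vH_vertex.
have [[M HM] momH] := spectral_density_moments H_law.
have Aae := rademacher_ae A_rad.
have mS b : measurable_fun setT (fun omega => Num.sqrt (3 + 2 * Y b omega)).
  apply: (measurableT_comp (continuous_measurable_fun _)) => //.
  exact: sqrt_continuous.
have mAS b : measurable_fun setT
    (fun omega => A omega * Num.sqrt (3 + 2 * Y b omega)).
  exact: measurable_funM.
have s0 t : 0 <= Num.sqrt (tri_symbol beta t) by exact: sqrtr_ge0.
have s3 t : Num.sqrt (tri_symbol beta t) <= 3.
  rewrite -[leRHS]ger0_norm// -sqrtr_sqr ler_wsqrtr//.
  by rewrite (le_trans (tri_symbol_le9 _ _))//; lra.
apply: (@cvg_in_distribution_moments _ _ _ _ _ _ _ _ _ (Num.max 3 M)) => //.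
- by rewrite lt_max ltr0n.
- move=> b; apply: filterS Aae => w Aw; rewrite le_max ZE normrM.
  rewrite (ger0_norm (s0 _)).
  by case: Aw => ->; rewrite ?normrN normr1 mul1r s3.
- by apply: filterS HM => w h; rewrite le_max h orbT.
move=> k; rewrite momH vHE -[k]odd_double_half.
case: (boolP (odd k)) => kodd; last first.
  (* Even moments: [A ^+ 2 = 1] almost surely, so an even power of [A * sqrt Z] is a power of
     [Z]. *)
  have := cvg_tri_symbol_moments (j := double) (k := k./2) beta_irr X_unif erefl
    (nb_walks_hex_double (lattice_point x0 y0 c) c).
  rewrite add0n; apply: cvg_trans; apply: near_eq_cvg; near=> b.
  apply: ae_eq_Rintegral.
  + by apply: measurable_funX => //; exact: mZ.
  + by apply: measurable_funX => //; exact: mAS.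
  + apply: filterS Aae => w Aw.
    rewrite exprMn -mul2n !exprM.
    rewrite sqr_sqrtr; last by rewrite ZE tri_symbol_ge0.
    by case: Aw => ->; rewrite ?sqrrN expr1n expr1n mul1r.
(* Odd moments: the hexagonal lattice has no closed walk of odd length, and the sign makes the
   moment exactly 0 for each [b > 0]. *)
rewrite nb_walks_hex_parity; last by rewrite addbb /= odd_double.
have : (fun _ : R => 0 : R) @ +oo%R --> (0 : R) by exact: cvg_cst.
apply: cvg_trans; apply: near_eq_cvg; near=> b.
have b0 : 0 < b by near: b; apply: nbhs_pinfty_gt; exact: num_real.
under eq_Rintegral do rewrite exprMn.
pose j := (true + (k./2).*2)%N.
apply/esym; apply: (@Rintegral_rademacher_odd _ _ _ P A (X b)
  (fun t => Num.sqrt (tri_symbol beta t) ^+ j) (3 ^+ j) j) => //.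
- exact: A_indep.
- apply: measurable_funX.
  apply: (measurableT_comp (continuous_measurable_fun _)) => //.
  exact: sqrt_continuous.
- by move=> t; rewrite lerXn2r ?nnegrE.
- by rewrite /= odd_double.
Unshelve. all: by end_near. Qed.
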